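(* Let $\mathfrak{g}$ be the Lie algebra over $\mathbb{Q}$ with basis $l_0,l_1,l_2,\ldots$ and bracket $$[l_n,l_m]=(n-m)\frac{(n+m+1)!}{(n+1)!(m+1)!}\,l_{n+m},$$ and let $\mathfrak{a}=\{\Psi\in\mathrm{Hom}_{\mathbb{Q}}(\mathbb{Q}[x],\mathbb{Q}[x])\mid\Psi(1)=0\}$. Then the linear map $\rho\colon\mathfrak{g}\to\mathrm{Hom}(\mathfrak{a},\mathfrak{a})$ given by $$\rho(l_n)(\Psi)=\left(\frac{x^n}{n!}-\frac{x^{n+1}\partial}{(n+1)!}\right)\circ\Psi-\Psi\circ\frac{x\partial^{n+1}}{(n+1)!}$$ is an injective morphism of Lie algebras.
   Context: $\partial=\frac{d}{dx}\colon\mathbb{Q}[x]\to\mathbb{Q}[x]$ is the usual derivative, and powers of $x$ act on $\mathbb{Q}[x]$ by multiplication; thus $x^{n+1}\partial$ is $p\mapsto x^{n+1}p'$ and $x\partial^{n+1}$ is $p\mapsto x\,p^{(n+1)}$. $\mathrm{Hom}(\mathfrak{a},\mathfrak{a})$ is the space of $\mathbb{Q}$-linear endomorphisms of $\mathfrak{a}$, with the commutator bracket. *)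

(* Defs.v *)
From HB Require Import structures.
From mathcomp Require Import all_boot all_order all_algebra.
From mathcomp Require Import boolp.
From mathcomp Require Import ssrAC ring.

Set Implicit Arguments.
Unset Strict Implicit.
Unset Printing Implicit Defensive.

Import GRing.Theory.
Local Open Scope ring_scope.

HB.mixin Record isLieAlgebra (R : comNzRingType) V of GRing.Lmodule R V := {
  lie : V -> V -> V;
  lie_linearl : forall (c : R) (x y z : V),
    lie (c *: x + y) z = c *: lie x z + lie y z;
  lie_linearr : forall (c : R) (x y z : V),
    lie z (c *: x + y) = c *: lie z x + lie z y;
  liexx : forall x : V, lie x x = 0;
  lie_jacobi : forall x y z : V,
    lie x (lie y z) + lie y (lie z x) + lie z (lie x y) = 0
}.

#[short(type="lieAlgType")]
HB.structure Definition LieAlgebra (R : comNzRingType) :=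
  {V of isLieAlgebra R V & GRing.Lmodule R V}.

Definition lie_morphism (R : comNzRingType) (L M : lieAlgType R)
    (f : {linear L -> M}) : Prop :=
  forall x y : L, f (lie x y) = lie (f x) (f y).

(* An alias of {linear U -> V}, made a module by the pointwise operations. *)
Definition Hom (R : comNzRingType) (U V : lmodType R) : Type := {linear U -> V}.
Identity Coercion hom_linear : Hom >-> GRing.Linear.type.

Section Hom.
Variables (R : comNzRingType) (U V : lmodType R).
Implicit Types f g h : Hom U V.

Lemma homP f g : (forall x, f x = g x) -> f = g.
Proof.
move=> /funext E; case: f g E => f [[fA] [fB]] /= [g [[gA] [gB]]] /= E.
by subst g; rewrite (Prop_irrelevance fA gA) (Prop_irrelevance fB gB).
Qed.

HB.instance Definition _ := gen_eqMixin (Hom U V).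
HB.instance Definition _ := gen_choiceMixin (Hom U V).

Definition hom0 : Hom U V := GRing.Linear.clone R U V *:%R \0 _.
Definition homN f : Hom U V := GRing.Linear.clone R U V *:%R (\- f) _.
Definition homD f g : Hom U V := GRing.Linear.clone R U V *:%R (f \+ g) _.
Definition homZ c f : Hom U V := GRing.Linear.clone R U V *:%R (c \*: f) _.

Fact homDA : associative homD.
Proof. by move=> f g h; apply: homP => x /=; rewrite addrA. Qed.
Fact homDC : commutative homD.
Proof. by move=> f g; apply: homP => x /=; rewrite addrC. Qed.
Fact hom0D : left_id hom0 homD.
Proof. by move=> f; apply: homP => x /=; rewrite add0r. Qed.
Fact homND : left_inverse hom0 homN homD.
Proof. by move=> f; apply: homP => x /=; rewrite addNr. Qed.

HB.instance Definition _ :=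
  GRing.isZmodule.Build (Hom U V) homDA homDC hom0D homND.

Fact homZA a b f : homZ a (homZ b f) = homZ (a * b) f.
Proof. by apply: homP => x /=; rewrite scalerA. Qed.
Fact hom1Z : left_id 1 homZ.
Proof. by move=> f; apply: homP => x /=; rewrite scale1r. Qed.
Fact homZDr : right_distributive homZ +%R.
Proof. by move=> a f g; apply: homP => x /=; rewrite scalerDr. Qed.
Fact homZDl f : {morph homZ^~ f : a b / a + b}.
Proof. by move=> a b; apply: homP => x /=; rewrite scalerDl. Qed.

HB.instance Definition _ :=
  GRing.Zmodule_isLmodule.Build R (Hom U V) homZA hom1Z homZDr homZDl.

Lemma hom0E x : (0 : Hom U V) x = 0. Proof. by []. Qed.
Lemma homDE f g x : (f + g) x = f x + g x. Proof. by []. Qed.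
Lemma homNE f x : (- f) x = - f x. Proof. by []. Qed.
Lemma homZE c f x : (c *: f) x = c *: f x. Proof. by []. Qed.

End Hom.

Section Commutator.
Variables (R : comNzRingType) (V : lmodType R).
Implicit Types f g h : Hom V V.

Definition commutator f g : Hom V V :=
  GRing.Linear.clone R V V *:%R ((f \o g) \- (g \o f)) _.

Lemma commutatorE f g x : commutator f g x = f (g x) - g (f x).
Proof. by []. Qed.

Fact commutator_linearl c f g h :
  commutator (c *: f + g) h = c *: commutator f h + commutator g h.
Proof.
apply: homP => x; rewrite !(homDE, homZE, commutatorE) linearD linearZ /=.
by rewrite scalerBr opprD addrACA.
Qed.
Fact commutator_linearr c f g h :
  commutator h (c *: f + g) = c *: commutator h f + commutator h g.
Proof.
apply: homP => x; rewrite !(homDE, homZE, commutatorE) linearD linearZ /=.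
by rewrite scalerBr opprD addrACA.
Qed.
Fact commutatorxx f : commutator f f = 0.
Proof. by apply: homP => x; rewrite commutatorE subrr. Qed.
Fact commutator_jacobi f g h :
  commutator f (commutator g h) + commutator g (commutator h f)
    + commutator h (commutator f g) = 0.
Proof.
apply: homP => x; rewrite !(homDE, commutatorE) !linearB /= !opprK !addrA.
rewrite (ACl (1*11*(2*8)*(3*5)*(4*10)*(6*12)*(7*9))) /=.
by rewrite !(subrr, addNr) !addr0.
Qed.

HB.instance Definition _ := isLieAlgebra.Build R (Hom V V)
  commutator_linearl commutator_linearr commutatorxx commutator_jacobi.

Lemma lie_homE f g x : lie f g x = f (g x) - g (f x). Proof. by []. Qed.

End Commutator.

(* galg is the Lie algebra g: the free Q-vector space on l_0, l_1, ... is realized on polynomials, used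
   only as finitely supported sequences of coefficients: l n is 'X^n. *)
Definition galg : Type := {poly rat}.
HB.instance Definition _ := GRing.Lmodule.on galg.

Definition l (n : nat) : galg := 'X^n.

Definition lin_ext (V : lmodType rat) (f : nat -> V) (u : galg) : V :=
  \sum_(i < size (u : {poly rat})) (u : {poly rat})`_i *: f i.

Section LinExt.
Variables (V : lmodType rat) (f : nat -> V).

Lemma lin_ext_widen (u : galg) m : (size (u : {poly rat}) <= m)%N ->
  lin_ext f u = \sum_(i < m) (u : {poly rat})`_i *: f i.
Proof.
move=> le_u_m; rewrite /lin_ext (big_ord_widen m (fun i => _`_i *: f i)) //.
rewrite big_mkcond; apply: eq_bigr => i _; case: ltnP => // le_i.
by rewrite nth_default // scale0r.
Qed.

Fact lin_ext_linear : linear (lin_ext f).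
Proof.
move=> c u v; pose m := maxn (size (u : {poly rat})) (size (v : {poly rat})).
have le_m : (size ((c *: u + v)%R : {poly rat}) <= m)%N.
  apply: leq_trans (size_polyD _ _) _; rewrite geq_max leq_maxr andbT.
  by apply: leq_trans (size_scale_leq _ _) _; rewrite leq_maxl.
rewrite (lin_ext_widen le_m) (lin_ext_widen (leq_maxl _ _ : _ <= m)%N).
rewrite (lin_ext_widen (leq_maxr _ _ : _ <= m)%N) scaler_sumr -big_split /=.
apply: eq_bigr => i _; have -> : ((c *: u + v)%R : {poly rat})`_i =
          c * (u : {poly rat})`_i + (v : {poly rat})`_i by rewrite coefD coefZ.
by rewrite scalerDl scalerA.
Qed.
HB.instance Definition _ :=
  GRing.isLinear.Build rat galg V *:%R (lin_ext f) lin_ext_linear.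

Lemma lin_ext_l n : lin_ext f (l n) = f n.
Proof.
rewrite /lin_ext size_polyXn big_ord_recr /= coefXn eqxx scale1r.
by rewrite big1 ?add0r // => i _; rewrite coefXn ltn_eqF // scale0r.
Qed.

End LinExt.

Lemma galg_basis (u : galg) : u = lin_ext l u.
Proof. by rewrite -[LHS](coefK (u : {poly rat})) poly_def. Qed.

Lemma galg_lin_eq (V : lmodType rat) (F G : {linear galg -> V}) :
  (forall n, F (l n) = G (l n)) -> F =1 G.
Proof.
move=> E u; rewrite (galg_basis u) !linear_sum /=.
by apply: eq_bigr => i _; rewrite !linearZ /= E.
Qed.

Definition lcoef (n m : nat) : rat :=
  (n%:R - m%:R) * (n + m).+1`!%:R / (n.+1`!%:R * m.+1`!%:R).

Definition galg_lie (u v : galg) : galg :=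
  lin_ext (fun n => lin_ext (fun m => lcoef n m *: l (n + m)) v) u.

Fact galg_lie_linearl c (u v w : galg) :
  galg_lie (c *: u + v) w = c *: galg_lie u w + galg_lie v w.
Proof. exact: linearP. Qed.

Fact galg_lie_linearr c (u v w : galg) :
  galg_lie w (c *: u + v) = c *: galg_lie w u + galg_lie w v.
Proof.
pose A x n : galg := lin_ext (fun m => lcoef n m *: l (n + m)) x.
have AP n : A (c *: u + v) n = c *: A u n + A v n by exact: linearP.
rewrite -![galg_lie w _]/(lin_ext (A _) w) /lin_ext scaler_sumr -big_split /=.
by apply: eq_bigr => i _; rewrite AP scalerDr !scalerA mulrC.
Qed.

(* Rescaling l_n to 'X^n / (n+1)! turns the bracket into that of the vector
   fields 'X * f * d/d'X. *)
Definition rescale (u : galg) : {poly rat} :=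
  lin_ext (fun n => n.+1`!%:R^-1 *: 'X^n : {poly rat}) u.
HB.instance Definition _ := GRing.isLinear.Build rat galg {poly rat} *:%R
  rescale (@lin_ext_linear _ _).

Lemma rescale_l n : rescale (l n) = n.+1`!%:R^-1 *: 'X^n.
Proof. exact: lin_ext_l. Qed.

Lemma natfact_neq0 n : n`!%:R != 0 :> rat.
Proof. by rewrite Num.Theory.pnatr_eq0 -lt0n fact_gt0. Qed.

Lemma coef_rescale u i : (rescale u)`_i = (u : {poly rat})`_i / i.+1`!%:R.
Proof.
rewrite /rescale /lin_ext; under eq_bigr do rewrite scalerA.
rewrite -(poly_def _ (fun i => (u : {poly rat})`_i / i.+1`!%:R)) coef_poly.
by case: ltnP => // le_u_i; rewrite nth_default // mul0r.
Qed.

Lemma rescale_inj : injective rescale.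
Proof.
move=> u v E; apply/polyP => i; have := congr1 (fun p : {poly rat} => p`_i) E.
by rewrite !coef_rescale => /mulIf; apply; rewrite invr_eq0 natfact_neq0.
Qed.

Definition xder (p : {poly rat}) : {poly rat} := 'X * p^`().
Fact xder_linear : linear xder.
Proof. by move=> c p q; rewrite /xder linearP mulrDr scalerAr. Qed.
HB.instance Definition _ :=
  GRing.isLinear.Build rat {poly rat} {poly rat} *:%R xder xder_linear.

Lemma xderXn n : xder 'X^n = n%:R *: 'X^n.
Proof.
rewrite /xder derivXn mulrnAr -scaler_nat.
by case: n => [|n]; rewrite ?scale0r // -exprS.
Qed.

Lemma xderM p q : xder (p * q) = xder p * q + p * xder q.
Proof. by rewrite /xder derivM; ring. Qed.

Lemma galg_lie_l n m : galg_lie (l n) (l m) = lcoef n m *: l (n + m).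
Proof. by rewrite /galg_lie !lin_ext_l. Qed.

Lemma galg_bilin_eq (V : lmodType rat) (F G : galg -> galg -> V) :
  (forall v, linear (F^~ v)) -> (forall u, linear (F u)) ->
  (forall v, linear (G^~ v)) -> (forall u, linear (G u)) ->
  (forall n m, F (l n) (l m) = G (l n) (l m)) -> forall u v, F u v = G u v.
Proof.
move=> Fl Fr Gl Gr E u v.
pose mk (H : galg -> V) (HL : linear H) : {linear galg -> V} :=
  HB.pack H (GRing.isLinear.Build _ _ _ _ H HL).
apply: (galg_lin_eq (F := mk _ (Fl v)) (G := mk _ (Gl v))) => n /=.
by apply: (galg_lin_eq (F := mk _ (Fr _)) (G := mk _ (Gr _))) => m /=.
Qed.

Lemma rescale_lie u v :
  rescale (galg_lie u v) =
  xder (rescale u) * rescale v - rescale u * xder (rescale v).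
Proof.
move: u v; apply: galg_bilin_eq.
- by move=> w c u v; rewrite galg_lie_linearl linearP.
- by move=> w c u v; rewrite galg_lie_linearr linearP.
- move=> w c u v; rewrite !linearP /= mulrDl mulrDl -!scalerAl scalerBr opprD.
  by rewrite addrACA.
- move=> w c u v; rewrite !linearP /= mulrDr mulrDr -!scalerAr scalerBr opprD.
  by rewrite addrACA.
move=> n m; rewrite galg_lie_l linearZ /= !rescale_l !linearZ /= !xderXn.
rewrite -!scalerAl -!scalerAr -exprD !scalerA -scalerBl; congr (_ *: _).
rewrite /lcoef; field.
by rewrite !natfact_neq0.
Qed.

Fact galg_liexx u : galg_lie u u = 0.
Proof. by apply: rescale_inj; rewrite rescale_lie linear0 mulrC subrr. Qed.

Fact galg_lie_jacobi u v w :
  galg_lie u (galg_lie v w) + galg_lie v (galg_lie w u)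
    + galg_lie w (galg_lie u v) = 0.
Proof.
apply: rescale_inj; rewrite !(linearD rescale) /= !rescale_lie (linear0 rescale).
rewrite !(linearB xder) /= !xderM.
by ring.
Qed.

HB.instance Definition _ := isLieAlgebra.Build rat galg
  galg_lie_linearl galg_lie_linearr galg_liexx galg_lie_jacobi.

Lemma lie_l n m : lie (l n) (l m) =
  ((n%:R - m%:R) * (n + m).+1`!%:R / (n.+1`!%:R * m.+1`!%:R)) *: l (n + m).
Proof. exact: galg_lie_l. Qed.

Definition kills1 : {pred Hom {poly rat} {poly rat}} :=
  fun Psi => Psi 1 == 0.

Fact kills1_submod : submod_closed kills1.
Proof.
split=> [|c f g /eqP f1 /eqP g1]; rewrite unfold_in //.
by rewrite homDE homZE f1 g1 scaler0 addr0.
Qed.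
HB.instance Definition _ :=
  GRing.isSubmodClosed.Build rat (Hom {poly rat} {poly rat}) kills1
    kills1_submod.

(* aalg is the space a of linear Psi : Q[x] -> Q[x] with Psi(1) = 0, as a
   subspace of Hom Q[x] Q[x]. *)
Record aalg := Aalg {
  aalg_val :> Hom {poly rat} {poly rat};
  _ : aalg_val \in kills1
}.
HB.instance Definition _ := [isSub for aalg_val].
HB.instance Definition _ := [Choice of aalg by <:].
HB.instance Definition _ := [SubChoice_isSubLmodule of aalg by <:].

Lemma aalg1 (Psi : aalg) : Psi 1 = 0.
Proof. by case: Psi => f /= /eqP. Qed.

Definition lop (n : nat) (p : {poly rat}) : {poly rat} :=
  n`!%:R^-1 *: ('X^n * p) - n.+1`!%:R^-1 *: ('X^(n.+1) * p^`()).

Definition rop (n : nat) (p : {poly rat}) : {poly rat} :=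
  n.+1`!%:R^-1 *: ('X * p^`(n.+1)).

Fact lop_linear n : linear (lop n).
Proof.
move=> c p q; rewrite /lop linearP /= !mulrDr -!scalerAr !scalerDr.
by rewrite scalerN opprD addrACA !scalerA ![c * _]mulrC.
Qed.
HB.instance Definition _ n :=
  GRing.isLinear.Build rat {poly rat} {poly rat} *:%R (lop n) (lop_linear n).

Fact rop_linear n : linear (rop n).
Proof.
move=> c p q; rewrite /rop linearP mulrDr -scalerAr scalerDr.
by rewrite !scalerA [c * _]mulrC.
Qed.
HB.instance Definition _ n :=
  GRing.isLinear.Build rat {poly rat} {poly rat} *:%R (rop n) (rop_linear n).

Lemma rop1 n : rop n 1 = 0.
Proof. by rewrite /rop derivSn derivC linear0 mulr0 scaler0. Qed.

Definition rho_gen_hom (n : nat) (Psi : aalg) : Hom {poly rat} {poly rat} :=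
  GRing.Linear.clone rat {poly rat} {poly rat} *:%R
    ((lop n \o Psi) \- (Psi \o rop n)) _.

Fact rho_gen_subproof n Psi : rho_gen_hom n Psi \in kills1.
Proof. by rewrite unfold_in /= rop1 aalg1 (linear0 (lop n)) (linear0 (aalg_val Psi)) subrr. Qed.

Definition rho_gen_fun (n : nat) (Psi : aalg) : aalg :=
  Aalg (rho_gen_subproof n Psi).

Fact rho_gen_linear n : linear (rho_gen_fun n).
Proof.
move=> c f g; apply: val_inj; apply: homP => p.
change (lop n (c *: f p + g p) - (c *: f (rop n p) + g (rop n p)) =
  c *: (lop n (f p) - f (rop n p)) + (lop n (g p) - g (rop n p))).
by rewrite linearP scalerBr opprD addrACA.
Qed.
HB.instance Definition _ n :=
  GRing.isLinear.Build rat aalg aalg *:%R (rho_gen_fun n) (rho_gen_linear n).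

Definition rho_gen (n : nat) : Hom aalg aalg :=
  GRing.Linear.clone rat aalg aalg *:%R (rho_gen_fun n) _.

(* The linear extension of l n |-> rho_gen n; see rho_l for its values. *)
Definition rho (u : galg) : Hom aalg aalg := lin_ext rho_gen u.
HB.instance Definition _ := GRing.isLinear.Build rat galg (Hom aalg aalg) *:%R
  rho (@lin_ext_linear _ _).

Lemma rho_l (n : nat) (Psi : aalg) (p : {poly rat}) :
  rho (l n) Psi p =
    n`!%:R^-1 *: ('X^n * Psi p) - n.+1`!%:R^-1 *: ('X^(n.+1) * (Psi p)^`())
    - Psi (n.+1`!%:R^-1 *: ('X * p^`(n.+1))).
Proof. by rewrite /rho lin_ext_l. Qed.

(* Main.v *)
Require Import Defs.
From HB Require Import structures.
From mathcomp Require Import all_boot all_algebra.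
From mathcomp Require Import ring.

Set Implicit Arguments.
Unset Strict Implicit.
Unset Printing Implicit Defensive.

Import GRing.Theory.
Local Open Scope ring_scope.

(** Writing [rho (l n) Psi = lop n \o Psi - Psi \o rop n], both [lop] and [rop]
    satisfy the relations of g, so the two actions, on the left and on the
    right, combine to a representation.  Injectivity is seen on one test
    element: for [Psi p = p`_1 *: 'X] the polynomial [rho (l n) Psi 'X] is a
    nonzero multiple of ['X^(n + 1)]. *)

Lemma lopXn n a :
  lop n 'X^a = ((n.+1%:R - a%:R) / n.+1`!%:R) *: 'X^(n + a).
Proof.
rewrite /lop derivXn mulrnAr -[_ *+ a]scaler_nat.
(* At a = 0 the truncated predecessor gives the wrong exponent, but the factor [a%:R] is then 0. *)
have -> : a%:R *: ('X^(n.+1) * 'X^(a.-1)) = a%:R *: 'X^(n + a) :> {poly rat}.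
  by case: a => [|a]; rewrite ?scale0r // -exprD addSnnS.
rewrite -exprD scalerA -scalerBl factS natrM; congr (_ *: _).
by field; rewrite natfact_neq0 nat1r Num.Theory.pnatr_eq0.
Qed.

Lemma lop_lie n m (p : {poly rat}) :
  lop n (lop m p) - lop m (lop n p) = lcoef n m *: lop (n + m) p.
Proof.
pose F : {linear {poly rat} -> {poly rat}} :=
  (lop n \o lop m) \- (lop m \o lop n).
pose G : {linear {poly rat} -> {poly rat}} := lcoef n m \*: lop (n + m).
(* Since [galg] is carried by [{poly rat}] and [l a] is ['X^a], linear maps on polynomials may be
   compared on monomials. What remains is (m+1-a)(n+1-m-a) - (n+1-a)(m+1-n-a) = (n-m)(n+m+1-a). *)
apply: (@galg_lin_eq _ F G) => a; rewrite /F /G /= !lopXn.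
rewrite [lop n _]linearZ [lop m _]linearZ /= !lopXn !scalerA.
rewrite addnCA !addnA (addnC m n) -scalerBl; congr (_ *: _).
rewrite /lcoef -!(@natr1 rat n) -(@natr1 rat m) -(@natr1 rat (n + m)).
rewrite (@natrD rat n m) (@natrD rat m a) (@natrD rat n a).
by field; rewrite !natfact_neq0.
Qed.

(** Leibniz rule: all derivatives of ['X] beyond the first vanish, so two terms survive. *)
Lemma derivnXM (p : {poly rat}) n :
  ('X * p)^`(n.+1) = 'X * p^`(n.+1) + p^`(n) *+ n.+1.
Proof.
have := derivnMXaddC n p 0.
by rewrite addr0 -!commr_polyX => ->; rewrite addrC.
Qed.

Lemma rop_comp n m (p : {poly rat}) :
  rop n (rop m p) = (n.+1`!%:R * m.+1`!%:R)^-1 *: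
    ('X * ('X * p^`((n + m).+2) + n.+1%:R *: p^`((n + m).+1))).
Proof.
have derivnA i j : p^`(i)^`(j) = p^`(j + i) by rewrite /derivn -iterD.
rewrite /rop derivnZ -scalerAr scalerA -invfM derivnXM !derivnA.
by rewrite !addnS addSn scaler_nat.
Qed.

Lemma rop_lie n m (p : {poly rat}) :
  rop n (rop m p) - rop m (rop n p) = lcoef n m *: rop (n + m) p.
Proof.
rewrite !rop_comp (addnC m n) (mulrC m.+1`!%:R) -scalerBr -mulrBr opprD.
rewrite addrACA subrr add0r -scalerBl -scalerAr /rop !scalerA.
congr (_ *: _); rewrite /lcoef -(@natr1 rat n) -(@natr1 rat m).
by field; rewrite !natfact_neq0.
Qed.

Lemma rho_genE n (Psi : aalg) p :
  rho_gen n Psi p = lop n (Psi p) - Psi (rop n p).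
Proof. by []. Qed.

(** Left and right composition commute, so the mixed terms such as [lop n \o Psi \o rop m] cancel.
    Precomposition reverses products, and the minus sign before [Psi \o rop n] compensates for
    this. *)
Lemma rho_gen_lie n m :
  lie (rho_gen n) (rho_gen m) = lcoef n m *: rho_gen (n + m).
Proof.
apply: homP => Psi; apply: val_inj; apply: homP => p.
change (rho_gen n (rho_gen m Psi) p - rho_gen m (rho_gen n Psi) p =
  lcoef n m *: rho_gen (n + m) Psi p).
have PsiR : lcoef n m *: Psi (rop (n + m) p) =
    Psi (rop n (rop m p)) - Psi (rop m (rop n p)).
  by rewrite -[RHS]linearB rop_lie [RHS]linearZ.
rewrite !rho_genE scalerBr -lop_lie PsiR.
rewrite [lop n (_ - _)]linearB [lop m (_ - _)]linearB /=.
by ring.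
Qed.

Lemma rho_lie u v : rho (lie u v) = lie (rho u) (rho v).
Proof.
move: u v; apply: galg_bilin_eq.
- by move=> w c u v; rewrite lie_linearl [LHS]linearP.
- by move=> w c u v; rewrite lie_linearr [LHS]linearP.
- by move=> w c u v; rewrite [rho (_ + _)]linearP [LHS]lie_linearl.
- by move=> w c u v; rewrite [rho (_ + _)]linearP [LHS]lie_linearr.
move=> n m; have rhol k : rho (l k) = rho_gen k := lin_ext_l rho_gen k.
by rewrite lie_l [LHS]linearZ /= !rhol rho_gen_lie.
Qed.

Definition coef1X (p : {poly rat}) : {poly rat} := p`_1 *: 'X.

Fact coef1X_linear : linear coef1X.
Proof.
by move=> c p q; rewrite /coef1X coefD coefZ scalerDl scalerA.
Qed.
HB.instance Definition _ :=
  GRing.isLinear.Build rat {poly rat} {poly rat} *:%R coef1X coef1X_linear.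

Definition coef1X_hom : Defs.Hom {poly rat} {poly rat} :=
  GRing.Linear.clone rat {poly rat} {poly rat} *:%R coef1X _.

Fact coef1X_kills1 : coef1X_hom \in kills1.
Proof. by rewrite unfold_in /= /coef1X coef1 scale0r. Qed.

Definition test_elt : aalg := Aalg coef1X_kills1.

(** For n > 0, [rop n 'X] is 0 and only [lop n 'X] contributes. Its factor (n+1-1)/(n+1)! vanishes
    at n = 0, where -1 comes from [rop 0 'X = 'X]. *)
Definition test_coef (n : nat) : rat :=
  if n is 0 then -1 else n%:R / n.+1`!%:R.

Lemma test_coef_neq0 n : test_coef n != 0.
Proof.
case: n => [|n] //=.
by rewrite mulf_neq0 ?invr_eq0 ?natfact_neq0 ?Num.Theory.pnatr_eq0.
Qed.

Lemma rho_gen_test n : rho_gen n test_elt 'X = test_coef n *: 'X^(n.+1).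
Proof.
have testE p : test_elt p = p`_1 *: 'X by [].
rewrite rho_genE !testE coefX scale1r -[X in lop n X]expr1 lopXn addn1.
rewrite -(@natr1 rat n) addrK; case: n => [|n].
  rewrite mul0r scale0r sub0r /rop derivn1 derivX invr1 scale1r mulr1 coefX.
  by rewrite scale1r scaleN1r expr1.
rewrite [rop _ _]/rop 2!derivSn derivX derivC linear0 mulr0 scaler0.
by rewrite coef0 scale0r subr0.
Qed.

Lemma rho_test (u : galg) :
  rho u test_elt 'X =
  \sum_(i < size (u : {poly rat}))
     ((u : {poly rat})`_i * test_coef i) *: 'X^(i.+1).
Proof.
rewrite /rho /lin_ext.
(* Evaluation at [test_elt] and then at ['X] is additive, hence passes through the sum. *)
rewrite (big_morph (fun f : Defs.Hom aalg aalg => f test_elt 'X) (id1 := 0)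
          (op1 := +%R)) //.
by apply: eq_bigr => i _; rewrite -scalerA -rho_gen_test.
Qed.

(** The coefficient of ['X^(n.+1)] in [rho u test_elt 'X] is the n-th coordinate of u times the
    nonzero [test_coef n]. *)
Lemma rho_eq0 (u : galg) : rho u = 0 -> u = 0.
Proof.
move=> u0; apply/polyP => n; rewrite coef0.
have := congr1 (fun p : {poly rat} => p`_n.+1) (rho_test u).
rewrite u0 coef0 coef_sum.
case: (ltnP n (size (u : {poly rat}))) => [lt_n|le_n]; last first.
  by rewrite nth_default.
rewrite (bigD1 (Ordinal lt_n)) //= big1 => [|i ne_i].
  rewrite coefZ coefXn eqxx mulr1 addr0 => /esym/eqP.
  by rewrite mulf_eq0 (negPf (test_coef_neq0 n)) orbF => /eqP.
by rewrite coefZ coefXn eqSS eq_sym (negPf ne_i : (i == n :> nat) = false) mulr0.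
Qed.

Theorem lemma6p2 : lie_morphism rho /\ injective rho.
Proof.
split; first exact: rho_lie.
move=> u v E; apply/eqP; rewrite -subr_eq0; apply/eqP/rho_eq0.
by rewrite linearB /= E subrr.
Qed.
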